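(* Let $A$ be a regular domain containing a field of characteristic zero, let $m\ge 1$, and let $R=A[X_1,\ldots,X_m]$ be graded by $\deg A=0$ and $\deg X_i=1$ for all $i$. Let $i\ge 0$ and let $J$ be a proper homogeneous ideal of $R$ such that $H^i_J(R)_n\neq 0$ for all $n\ge 0$ and $H^i_J(R)_n=0$ for all $n<0$. Then there exists a proper ideal $Q$ of $A$ such that $J\subseteq QR$.
   Context: Regular rings are commutative and Noetherian. $H^i_J(R)$ denotes the $i$-th local cohomology module of $R$ with support in $J$; it is a graded $R$-module, and $H^i_J(R)_n$ is its degree $n$ component. *)

(* Defs.v *)
(* Ideals are arbitrary Prop-valued predicates: the ideals of ring_quotient are
   boolean, hence decidable, and are proper by definition. *)
From HB Require Import structures.
From mathcomp Require Import all_boot all_order all_algebra.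
From mathcomp Require Import mpoly.

Set Implicit Arguments.
Unset Strict Implicit.
Unset Printing Implicit Defensive.

Import Order.TTheory GRing.Theory Num.Theory.
Local Open Scope ring_scope.

Section Ideals.
Variable R : comNzRingType.
Implicit Types I J P M : R -> Prop.

Definition ideal I : Prop :=
  [/\ I 0, forall x y, I x -> I y -> I (x + y) & forall a x, I x -> I (a * x)].

Definition is_proper_ideal I : Prop := ideal I /\ ~ I 1.

Definition subideal I J : Prop := forall x, I x -> J x.

Definition gen_ideal (S : R -> Prop) : R -> Prop := fun x =>
  exists (n : nat) (a s : 'I_n -> R),
    (forall k, S (s k)) /\ x = \sum_(k < n) a k * s k.

Definition ideal_pow J (k : nat) : R -> Prop :=
  gen_ideal (fun x => exists f : 'I_k -> R,
    (forall j, J (f j)) /\ x = \prod_(j < k) f j).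

Definition generated_by (n : nat) I : Prop :=
  exists g : 'I_n -> R,
    forall x, I x <-> gen_ideal (fun y => exists k, y = g k) x.

Definition noetherian : Prop :=
  forall I, ideal I -> exists n, generated_by n I.

Definition prime_ideal P : Prop :=
  is_proper_ideal P /\ forall x y, P (x * y) -> P x \/ P y.

Definition maximal_ideal M : Prop :=
  is_proper_ideal M /\ forall I, is_proper_ideal I -> subideal M I -> subideal I M.

Definition prime_chain (d : nat) : Prop :=
  exists P : nat -> R -> Prop,
    (forall k, (k <= d)%N -> prime_ideal (P k)) /\
    (forall k, (k < d)%N -> subideal (P k) (P k.+1) /\ ~ subideal (P k.+1) (P k)).

Definition krull_dim (d : nat) : Prop := prime_chain d /\ ~ prime_chain d.+1.

Definition local_ring M : Prop :=
  maximal_ideal M /\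
  forall N, maximal_ideal N -> forall x, N x <-> M x.

Definition regular_local_ring : Prop :=
  noetherian /\
  exists M d, [/\ local_ring M, krull_dim d & generated_by d M].

End Ideals.

Definition is_localization_at (A : comNzRingType) (P : A -> Prop)
    (S : comNzRingType) (phi : {rmorphism A -> S}) : Prop :=
  [/\ forall s, ~ P s -> exists t, phi s * t = 1,
      forall x, exists a s, ~ P s /\ phi s * x = phi a &
      forall a, phi a = 0 -> exists s, ~ P s /\ s * a = 0].

Definition regular_ring (A : comNzRingType) : Prop :=
  noetherian A /\
  forall P : A -> Prop, prime_ideal P ->
  forall (S : comNzRingType) (phi : {rmorphism A -> S}),
    is_localization_at P phi -> regular_local_ring S.

Section GradedModules.
Variables (A : comNzRingType) (m : nat).
Local Notation R := {mpoly A[m]}.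

Definition homogeneous_ideal (J : R -> Prop) : Prop :=
  ideal J /\ forall f (d : nat), J f -> J (pihomog mdeg d f).

(* The extension QR of an ideal Q of A. *)
Definition extended_ideal (Q : A -> Prop) : R -> Prop :=
  gen_ideal (fun f => exists2 q, Q q & f = q%:MP).

(* The additive subgroups gr n make M a Z-graded R-module; the last two
   conditions say that M is their internal direct sum. *)
Definition is_grading (M : lmodType R) (gr : int -> M -> Prop) : Prop :=
  [/\ forall n, gr n 0 /\ forall x y, gr n x -> gr n y -> gr n (x - y),
      forall (d : nat) n f x, f \is d.-homog -> gr n x -> gr (d%:Z + n) (f *: x),
      forall x, exists (s : seq int) (c : int -> M),
        (forall n, gr n (c n)) /\ x = \sum_(n <- s) c n &
      forall (s : seq int) (c : int -> M), uniq s -> (forall n, gr n (c n)) ->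
        \sum_(n <- s) c n = 0 -> forall n, n \in s -> c n = 0].

Record gmodule := GModule {
  gcar :> lmodType R;
  gpart : int -> gcar -> Prop;
  gpartP : is_grading gpart
}.

Definition ring_gpart (n : int) : R^o -> Prop :=
  match n with
  | Posz d => fun f => (f : R) \is d.-homog
  | Negz _ => fun f => f = 0
  end.

Lemma ring_gpartP : is_grading ring_gpart.
Proof.
have g0 n : ring_gpart n 0 by case: n => n //=; exact: dhomog0.
split.
- move=> n; split=> // x y; case: n => n /=; first exact: rpredB.
  by move=> -> ->; rewrite subr0.
- move=> d [n|n] f x hf hx; last by rewrite /= in hx; rewrite hx scaler0.
  exact: dhomogM hf hx.
- move=> x; exists [seq Posz i | i <- iota 0 (msize x)].
  exists (fun n => if n is Posz d then pihomog mdeg d x else 0); split.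
    by case=> n //=; exact: pihomogP.
  rewrite big_map; have -> : iota 0 (msize x) = index_iota 0 (msize x).
    by rewrite /index_iota subn0.
  rewrite big_mkord.
  apply: pihomog_partitionE; exact: leqnn.
- move=> s c us hc h0 [d|d] hn; last exact: (hc (Negz d)).
  have := congr1 (pihomog mdeg d) h0; rewrite raddf0 raddf_sum /=.
  rewrite (bigD1_seq (Posz d)) //= pihomog_dE; last exact: (hc (Posz d)).
  rewrite big1 ?addr0 // => -[e|e] ne.
    by rewrite (@pihomog_ne0 _ _ _ e) //; exact: (hc (Posz e)).
  by have /= -> := hc (Negz e); rewrite raddf0.
Qed.

Definition ring_gmodule : gmodule := GModule ring_gpartP.

(* Homogeneous of degree 0. *)
Definition graded_map (M N : gmodule) (u : {linear M -> N}) : Prop :=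
  forall n x, gpart n x -> gpart n (u x).

(* Injective object of the category of graded R-modules. *)
Definition graded_injective (E : gmodule) : Prop :=
  forall (M N : gmodule) (u : {linear M -> N}) (f : {linear M -> E}),
    graded_map u -> injective u -> graded_map f ->
    exists2 g : {linear N -> E}, graded_map g & forall x, g (u x) = f x.

Record graded_injective_resolution (M : gmodule) := GInjRes {
  res :> nat -> gmodule;
  dif : forall k, {linear res k -> res k.+1};
  aug : {linear M -> res 0%N};
  dif_graded : forall k, graded_map (dif k);
  aug_graded : graded_map aug;
  res_injective : forall k, graded_injective (res k);
  aug_inj : injective aug;
  res_exact0 : forall x, dif 0%N x = 0 <-> exists r, aug r = x;
  res_exact : forall k x, dif k.+1 x = 0 <-> exists y, dif k y = x
}.

(* Gamma_J(M) *)
Definition torsion (J : R -> Prop) (M : gmodule) (x : M) : Prop :=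
  exists k : nat, forall f, ideal_pow J k f -> f *: x = 0.

(* H^i_J(M) is the i-th cohomology of the complex Gamma_J(I), for an injective
   resolution I of M in the category of graded modules; this is also what gives
   H^i_J(M) its grading (up to isomorphism, I does not matter). *)
Section LocalCohomology.
Variables (J : R -> Prop) (M : gmodule) (I : graded_injective_resolution M).

Definition lc_cocycle (i : nat) (x : I i) : Prop :=
  torsion J x /\ dif I i x = 0.

Definition lc_coboundary (i : nat) : I i -> Prop :=
  match i with
  | 0%N => fun x => x = 0
  | k.+1 => fun x => exists2 y : I k, torsion J y & dif I k y = x
  end.

(* H^i_J(M)_n = 0: this component consists of the classes of the cocycles of
   degree n. *)
Definition lc_part_eq0 (i : nat) (n : int) : Prop :=
  forall x : I i, gpart n x -> lc_cocycle x -> lc_coboundary x.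

End LocalCohomology.

End GradedModules.

(* Main.v *)
Require Import Defs.
From HB Require Import structures.
From mathcomp Require Import all_boot all_order all_algebra.
From mathcomp Require Import mpoly.
From mathcomp Require Import boolp ring zify.

(** Write d_j for the partial derivative with respect to X_j.  Each d_j acts
    on M = H^i_J(R) as an additive operator of degree -1 satisfying the Leibniz
    rule d_j (f u) = (d_j f) u + f (d_j u).  As M vanishes in degree -1, every u
    in M_0 is killed by all the d_j, so f u = 0 implies (d_j f) u = 0: the
    annihilator of u is an ideal of R stable under all the d_j
    ([class_ann_differential]).

    In characteristic zero the radical of such a differential ideal is again
    differential ([radical_differential]), and a differential ideal of
    A[X_1, ..., X_m] contains all the coefficients of its members
    ([differential_ideal_coeff]).  Since u is J-torsion, the radical of Ann(u)
    contains J, hence the ideal Q of A generated by the coefficients of the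
    elements of J.  If Q contained 1, then u would be 0 for every u in M_0,
    contradicting M_0 <> 0.  So Q is proper, and J is contained in QR by
    construction.

    The operators d_j on local cohomology are produced on the injective
    resolution itself, one term after the other.  A Leibniz operator on E is the
    same as a linear section of the projection E x E -> E, where R acts on E x E
    by f (x, y) = (f x, f y + (d_j f) x); injectivity of E gives such a section
    with prescribed values on the image of the preceding differential
    ([injective_extend], [derivation_lift], [resolution_derivation]). *)

Set Implicit Arguments.
Unset Strict Implicit.
Unset Printing Implicit Defensive.

Import Order.TTheory GRing.Theory Num.Theory.
Local Open Scope ring_scope.

(** * Ideals, radicals and derivations *)

Section IdealFacts.
Variable R : comNzRingType.
Implicit Types I : R -> Prop.

Lemma idealN I x : ideal I -> I x -> I (- x).
Proof. by case=> _ _ hM hx; rewrite -mulN1r; exact: hM. Qed.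

Lemma ideal_sum I (T : eqType) (s : seq T) (F : T -> R) :
  ideal I -> (forall t, t \in s -> I (F t)) -> I (\sum_(t <- s) F t).
Proof.
case=> h0 hD _ hF; elim: s hF => [|t s IHs] hF; first by rewrite big_nil.
rewrite big_cons; apply: (hD); first by apply: hF; rewrite mem_head.
by apply: IHs => t' ht'; apply: hF; rewrite inE ht' orbT.
Qed.

Lemma gen_idealP (S : R -> Prop) : ideal (gen_ideal S).
Proof.
split.
- by exists 0%N, (fun=> 0), (fun=> 0); split; [case | rewrite big_ord0].
- move=> x y [n [a [s [hs ->]]]] [p [b [t [ht ->]]]].
  exists (n + p)%N.
  exists (fun k => match split k with inl i => a i | inr i => b i end).
  exists (fun k => match split k with inl i => s i | inr i => t i end).
  split=> [k|]; first by case: (split k).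
  rewrite big_split_ord; congr (_ + _); apply: eq_bigr => k _.
    by rewrite -[lshift _ _]/(unsplit (inl k)) unsplitK.
  by rewrite -[rshift _ _]/(unsplit (inr k)) unsplitK.
- move=> c x [n [a [s [hs ->]]]]; exists n, (fun k => c * a k), s; split=> //.
  by rewrite mulr_sumr; apply: eq_bigr => k _; rewrite mulrA.
Qed.

Lemma gen_ideal_incl (S : R -> Prop) x : S x -> gen_ideal S x.
Proof.
by move=> hx; exists 1%N, (fun=> 1), (fun=> x); rewrite big_ord1 mul1r.
Qed.

Lemma gen_ideal_min (S : R -> Prop) I :
  ideal I -> subideal S I -> subideal (gen_ideal S) I.
Proof.
move=> hI hS x [n [a [s [hs ->]]]]; apply: ideal_sum => // k _.
by case: hI => _ _; apply; exact/hS/hs.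
Qed.

Definition radical I : R -> Prop := fun x => exists k : nat, I (x ^+ k).

Lemma radical_ideal I : ideal I -> ideal (radical I).
Proof.
move=> idI; have [h0 hD hM] := idI; split.
- by exists 1%N; rewrite expr1.
- move=> x y [k hk] [l hl]; exists (k + l)%N.
  rewrite exprDn; apply: ideal_sum => // t _; rewrite -mulr_natl; apply: (hM).
  have [lkt|ltk] := leqP l t.
    have -> : y ^+ t = y ^+ (t - l) * y ^+ l by rewrite -exprD subnK.
    by rewrite mulrA; exact: hM.
  have -> : ((k + l) - t = (l - t) + k)%N by lia.
  by rewrite exprD mulrC mulrA; exact: hM.
- by move=> a x [k hk]; exists k; rewrite exprMn; apply: (hM).
Qed.

Section Differential.
Variables (dlt : R -> R).
Hypothesis dltM : forall f g, dlt (f * g) = dlt f * g + f * dlt g.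

Lemma derivation1 : dlt 1 = 0.
Proof.
by apply: (@addrI _ (dlt 1)); rewrite -{3}[1]mulr1 dltM mulr1 mul1r addr0.
Qed.

Lemma derivationX f n : dlt (f ^+ n.+1) = n.+1%:R * f ^+ n * dlt f.
Proof.
elim: n => [|n IHn]; first by rewrite expr1 expr0 !mul1r.
by rewrite exprS dltM IHn; rewrite exprS; ring.
Qed.

(** Differentiating f ^ (a + 1) * g ^ b, where g is the derivative of f, and
    multiplying by g trades one factor f for two factors g, up to an element of
    the ideal and an invertible integer; so f ^ n in I gives g ^ (2 n) in I. *)
Lemma radical_differential I f :
    ideal I -> (forall n, exists b : R, b * n.+1%:R = 1) ->
    (forall g, I g -> I (dlt g)) -> radical I f -> radical I (dlt f).
Proof.
move=> [h0 hD hM] natU dI [n hn]; exists (n.*2); set g := dlt f.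
suff H a b : I (f ^+ a * g ^+ b) -> I (g ^+ (a.*2 + b)).
  by have := H n 0%N; rewrite expr0 mulr1 addn0; exact.
elim: a b => [|a IHa] b; first by rewrite mul1r.
move=> hab; have -> : (a.+1.*2 + b = a.*2 + b.+2)%N by rewrite doubleS; lia.
apply: IHa; have [c hc] := natU a.
have hb : dlt (g ^+ b) * g = b%:R * g ^+ b * dlt g.
  case: b {hab} => [|b]; first by rewrite derivation1 !mul0r.
  by rewrite derivationX exprS; ring.
have -> : f ^+ a * g ^+ b.+2 = (c * g) * dlt (f ^+ a.+1 * g ^+ b)
    + (- c * b%:R * dlt g) * (f ^+ a.+1 * g ^+ b).
  rewrite dltM derivationX -/g mulrDr.
  transitivity (c * a.+1%:R * (f ^+ a * g ^+ b.+2) + c * f ^+ a.+1 *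
     (dlt (g ^+ b) * g) + - c * b%:R * dlt g * (f ^+ a.+1 * g ^+ b)).
    by rewrite hb hc; rewrite !exprS; ring.
  by rewrite !exprS; ring.
by apply: (hD); apply: (hM) => //; exact: dI.
Qed.
End Differential.
End IdealFacts.

Section Coefficients.
Variables (A : comNzRingType) (m : nat).
Local Notation R := {mpoly A[m]}.
Hypothesis natU : forall n, exists b : A, b * n.+1%:R = 1.

(** A coefficient of a monomial other than 1 is, up to an invertible integer, a
    coefficient of a partial derivative, which has smaller degree.  The constant
    term is what remains once all other terms are subtracted. *)
Lemma differential_ideal_coeff (I : R -> Prop) f a :
    ideal I -> (forall j g, I g -> I g^`M(j)) -> I f -> I (f@_a)%:MP.
Proof.
move=> idI dI; have [h0 hD hM] := idI.
suff H n g : I g -> (forall b, (n <= mdeg b)%N -> g@_b = 0) ->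
    forall b, I (g@_b)%:MP.
  move=> If; apply: (H (msize f)) => // b hb; apply: memN_msupp_eq0.
  by apply/negP => /msize_mdeg_lt; rewrite ltnNge hb.
elim: n g => [|n IHn] g Ig gz b; first by rewrite gz // mpolyC0.
have hb c : c != 0%MM -> I (g@_c)%:MP.
  move=> c0; have [j hj] : exists j, c j != 0%N.
    apply/existsP; rewrite -negb_forall; apply: contra c0 => /forallP c0.
    by apply/eqP/mnmP => j; rewrite mnm0E; exact/eqP.
  have -> : c = (c - U_(j) + U_(j))%MM.
    by rewrite submK //; apply/mnm_lepP => l; rewrite mnm1E; case: eqP => // <-; lia.
  set d := (c - U_(j))%MM; have [u hu] := natU (d j).
  have -> : (g@_(d + U_(j)))%:MP = u%:MP * (g^`M(j)@_d)%:MP :> R.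
    by rewrite mcoeff_mderiv -mpolyCM -mulr_natl mulrA hu mul1r.
  apply: (hM); apply: IHn; first exact: dI.
  move=> e he; rewrite mcoeff_mderiv gz ?mul0rn //.
  by rewrite mdegD mdeg1; lia.
have [->|] := eqVneq b 0%MM; last exact: hb.
have -> : (g@_0)%:MP = g - \sum_(c <- msupp g | c != 0%MM) g@_c *: 'X_[c].
  apply/eqP; rewrite eq_sym subr_eq {1}[g]mpolyE addrC.
  rewrite (bigID (fun c => c != 0%MM)) /=; apply/eqP; congr (_ + _).
  under eq_bigl do rewrite negbK.
  have [h|h] := boolP (0%MM \in msupp g).
    rewrite -big_filter filter_pred1_uniq ?msupp_uniq // big_seq1.
    by rewrite mpolyX0 alg_mpolyC.
  rewrite memN_msupp_eq0 // mpolyC0 big_seq_cond big1 // => c /andP[hc /eqP c0].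
  by rewrite c0 (negbTE h) in hc.
apply: (hD) => //; apply: idealN => //; rewrite big_mkcond.
apply: ideal_sum => // c _; case: ifP => // hc.
by rewrite -mul_mpolyC mulrC; apply: (hM); exact: hb.
Qed.
End Coefficients.

(** * Graded modules and extension of graded maps *)

Section GradedFacts.
Variables (A : comNzRingType) (m : nat).
Local Notation R := {mpoly A[m]}.
Implicit Types M N E : gmodule A m.

Lemma gpart0 M n : gpart n (0 : M).
Proof. by case: (gpartP M) => h _ _ _; case: (h n). Qed.

Lemma gpartB M n (x y : M) : gpart n x -> gpart n y -> gpart n (x - y).
Proof. by case: (gpartP M) => h _ _ _; case: (h n) => _; apply. Qed.

Lemma gpartD M n (x y : M) : gpart n x -> gpart n y -> gpart n (x + y).
Proof.
move=> hx hy; rewrite -[y]opprK; apply: gpartB => //.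
by rewrite -sub0r; apply: gpartB => //; exact: gpart0.
Qed.

Lemma gpartMn M n (x : M) k : gpart n x -> gpart n (x *+ k).
Proof.
move=> hx; elim: k => [|k IHk]; first exact: gpart0.
by rewrite mulrS; exact: gpartD.
Qed.

Lemma gpartZ M (d : nat) n f (x : M) :
  f \is d.-homog -> gpart n x -> gpart (d%:Z + n) (f *: x).
Proof. by case: (gpartP M) => _ h _ _; apply: h. Qed.

(** The index set may be enlarged at will, so that several elements can be
    decomposed over a common one. *)
Lemma gpart_decomp M (x : M) : exists (s : seq int) (c : int -> M),
  (forall n, gpart n (c n)) /\
  forall t, uniq t -> {subset s <= t} -> x = \sum_(n <- t) c n.
Proof.
have [_ _ /(_ x) [s [c [hc ->]]] _] := gpartP M.
exists s, (fun n => c n *+ count_mem n s).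
split=> [n|t ut st]; first exact: gpartMn.
elim: s st => [|k s IHs] st; first by rewrite big_nil big1.
rewrite big_cons IHs => [|n hn]; last by apply: st; rewrite inE hn orbT.
under [in RHS]eq_bigr do rewrite /= mulrnDr.
rewrite big_split; congr (_ + _).
rewrite (bigD1_seq k) //=; last by apply: st; rewrite mem_head.
by rewrite eqxx big1 ?addr0 // => n /negbTE; rewrite eq_sym => ->.
Qed.

Lemma gpart_uniq M (s : seq int) (c : int -> M) : uniq s ->
  (forall n, gpart n (c n)) -> \sum_(n <- s) c n = 0 ->
  forall n, n \in s -> c n = 0.
Proof. by case: (gpartP M) => _ _ _; apply. Qed.

Lemma graded_map_lift M N (u : {linear M -> N}) n (z : M) :
  graded_map u -> gpart n (u z) -> exists2 z', gpart n z' & u z' = u z.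
Proof.
move=> gu hz; have [s [c [hc hs]]] := gpart_decomp z.
have zE : z = \sum_(k <- undup (n :: s)) c k.
  by apply: hs; rewrite ?undup_uniq // => k hk; rewrite mem_undup inE hk orbT.
rewrite zE in hz *.
exists (c n) => //; apply/eqP; rewrite -subr_eq0; apply/eqP.
set t := undup _ in hz *; have nt : n \in t by rewrite mem_undup mem_head.
(* The homogeneous decomposition of 0 = u z - u z, uniqueness of which gives
   u (c n) = u z. *)
pose e k := u (c k) - (if k == n then u (\sum_(k <- t) c k) else 0).
suff : e n = 0 by rewrite /e eqxx.
apply: (@gpart_uniq _ t) => //; first exact: undup_uniq.
  by move=> k; apply: gpartB; [exact: gu | case: eqP => [->|_] //; exact: gpart0].
have sumy (y : N) : \sum_(k <- t) (if k == n then y else 0) = y.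
  rewrite (bigD1_seq n) ?undup_uniq//= eqxx big1 ?addr0 // => k.
  by move/negbTE->.
by rewrite sumrB sumy raddf_sum subrr.
Qed.

Section Image.
Variables (M N : gmodule A m) (u : {linear M -> N}).
Hypothesis gu : graded_map u.

Definition im_pred : pred N := fun y => `[< exists x, u x = y >].

Lemma im_predP y : reflect (exists x, u x = y) (y \in im_pred).
Proof. exact: asboolP. Qed.

Lemma im_submod_closed : submod_closed im_pred.
Proof.
split; first by apply/im_predP; exists 0; rewrite raddf0.
move=> a _ _ /im_predP[x <-] /im_predP[y <-].
by apply/im_predP; exists (a *: x + y); rewrite linearP.
Qed.

HB.instance Definition _ := GRing.isSubmodClosed.Build R N im_pred
  im_submod_closed.

Record imsub := ImSub { imsub_val :> N; _ : imsub_val \in im_pred }.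
HB.instance Definition _ := [isSub for imsub_val].
HB.instance Definition _ := [Choice of imsub by <:].
HB.instance Definition _ := [SubChoice_isSubLmodule of imsub by <:].

Lemma imsub_is_grading :
  is_grading (fun n (y : imsub) => gpart n (val y)).
Proof.
split.
- move=> n; split; first by rewrite raddf0; exact: gpart0.
  by move=> x y hx hy; rewrite raddfB; exact: gpartB.
- by move=> d n f x hf hx; rewrite linearZ; exact: gpartZ.
- move=> y; have /im_predP[x ux] := valP y.
  have [s [c [hc hs]]] := gpart_decomp x.
  have iu k : u (c k) \in im_pred by apply/im_predP; exists (c k).
  exists (undup s), (fun k => ImSub (iu k)); split=> [n|]; first exact: gu.
  apply: val_inj; rewrite raddf_sum /= -raddf_sum /= -ux; congr (u _).
  by apply: hs; rewrite ?undup_uniq // => k; rewrite mem_undup.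
- move=> s c us hc /(congr1 val); rewrite raddf_sum raddf0 => hs n ns.
  by apply: val_inj; rewrite raddf0; exact: (gpart_uniq us hc).
Qed.

Definition imsub_gmodule : gmodule A m := GModule imsub_is_grading.

(** The injective map to which injectivity of E is applied is the inclusion of
    the image of u; f factors through that image since ker u is in ker f. *)
Lemma injective_extend (E : gmodule A m) (f : {linear M -> E}) :
  graded_injective E -> graded_map f -> (forall x, u x = 0 -> f x = 0) ->
  exists2 g : {linear N -> E}, graded_map g & forall x, g (u x) = f x.
Proof.
move=> Einj gf kuf.
have fE x y : u x = u y -> f x = f y.
  move=> xy; apply/eqP; rewrite -subr_eq0 -raddfB; apply/eqP/kuf.
  by rewrite raddfB; apply/eqP; rewrite subr_eq0; exact/eqP.
have ex (y : imsub) : exists x, u x = val y by apply/im_predP/valP.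
pose h (y : imsub_gmodule) : E := f (projT1 (cid (ex y))).
have hE (y : imsub_gmodule) x : u x = val y -> h y = f x.
  by move=> xy; apply: fE; case: cid => z /= ->.
have h_lin : linear h.
  move=> a y z; case: (ex y) (ex z) => [x hx] [x' hx'].
  rewrite (hE y x) // (hE z x') // -linearP.
  by apply: hE; rewrite linearP hx hx' linearP.
pose hl := GRing.isLinear.Build _ _ _ _ h h_lin.
pose H : {linear imsub_gmodule -> E} := HB.pack h hl.
have gH : graded_map H.
  move=> n y; have [x hx] := ex y => /= hy.
  have [|x' hx' xx'] := graded_map_lift (n := n) (z := x) gu; first by rewrite hx.
  by rewrite (hE y x') ?xx' //; exact: gf.
have gV : graded_map (val : {linear imsub_gmodule -> N}) by [].
have [g gg gE] := Einj _ _ _ H gV val_inj gH.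
exists g => // x; have ux : u x \in im_pred by apply/im_predP; exists x.
by rewrite (gE (ImSub ux)); exact: hE.
Qed.
End Image.
End GradedFacts.

(** * Lifting a derivation to an injective module *)

Lemma mderiv_homog (A : comNzRingType) m (j : 'I_m) (d : nat) (f : {mpoly A[m]}) :
  f \is d.+1.-homog -> f^`M(j) \is d.-homog.
Proof.
move=> hf; apply/dhomogP => a; rewrite mcoeff_msupp mcoeff_mderiv => ha.
apply/eqP; rewrite -eqSS; apply: contraNT ha => ha.
by rewrite (dhomog_nemf_coeff hf) ?mul0rn //= mdegD mdeg1 addn1.
Qed.

Lemma mderiv_homog0 (A : comNzRingType) m (j : 'I_m) (f : {mpoly A[m]}) :
  f \is 0.-homog -> f^`M(j) = 0.
Proof.
move=> hf; apply/mpolyP => a; rewrite mcoeff_mderiv mcoeff0.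
by rewrite (dhomog_nemf_coeff hf) ?mul0rn //= mdegD mdeg1 addn1.
Qed.

Section Twist.
Variables (A : comNzRingType) (m : nat).
Local Notation R := {mpoly A[m]}.
Variable j : 'I_m.

(** With w the identity of E, linear sections of the first projection are the
    Leibniz operators on E.  With a general w it is the pullback of that module
    along w, an extension of M by E. *)
Definition twist (M E : lmodType R) (w : {linear M -> E}) : Type := (M * E)%type.

Section TwistModule.
Variables (M E : lmodType R) (w : {linear M -> E}).

HB.instance Definition _ := GRing.Zmodule.copy (twist w) (M * E)%type.

Definition twist_scale (f : R) (x : twist w) : twist w :=
  (f *: x.1, f *: x.2 + f^`M(j) *: w x.1).

Lemma twist_scaleA f g x :
  twist_scale f (twist_scale g x) = twist_scale (f * g) x.
Proof.
congr pair => /=; first exact: scalerA.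
rewrite scalerDr !scalerA linearZ /= scalerA mderivM scalerDl -addrA.
by congr (_ + _); rewrite addrC (mulrC f).
Qed.

Lemma twist_scale1 : left_id 1 twist_scale.
Proof.
by case=> x y; congr pair; rewrite /= ?scale1r // -mpolyC1 mderivC scale0r addr0.
Qed.

Lemma twist_scaleDr : right_distributive twist_scale +%R.
Proof.
move=> f x y; congr pair; first exact: scalerDr.
have -> : w (x + y).1 = w x.1 + w y.1 by exact: raddfD.
have -> : (x + y).2 = x.2 + y.2 by [].
by rewrite /= !scalerDr addrACA.
Qed.

Lemma twist_scaleDl x : {morph twist_scale^~ x : f g / f + g}.
Proof.
move=> f g; congr pair; first exact: scalerDl.
by rewrite /= mderivD !scalerDl addrACA.
Qed.

HB.instance Definition _ := GRing.Zmodule_isLmodule.Build R (twist w)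
  twist_scaleA twist_scale1 twist_scaleDr twist_scaleDl.

End TwistModule.

Section TwistGraded.
Variables (M E : gmodule A m) (w : {linear M -> E}).
Hypothesis gw : graded_map w.

(** The first factor is shifted, as differentiation lowers degrees by 1; the
    shift is put there so that the inclusion of E has degree 0. *)
Definition twist_gpart (n : int) (x : twist w) : Prop :=
  gpart (n + 1) x.1 /\ gpart n x.2.

Lemma twist_sum (T : Type) (s : seq T) (c : T -> twist w) :
  \sum_(t <- s) c t = (\sum_(t <- s) (c t).1, \sum_(t <- s) (c t).2).
Proof.
elim: s => [|t s IHs]; first by rewrite !big_nil.
by rewrite !big_cons IHs.
Qed.

Lemma sum_shift (V : zmodType) (s : seq int) (c : int -> V) :
  \sum_(n <- s) c (n + 1) = \sum_(n <- [seq n + 1 | n <- s]) c n.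
Proof. by rewrite big_map. Qed.

Lemma twist_is_grading : is_grading twist_gpart.
Proof.
split.
- move=> n; split; first by split; exact: gpart0.
  by move=> x y [hx1 hx2] [hy1 hy2]; split; exact: gpartB.
- move=> d n f x hf [hx1 hx2]; split; rewrite /= ?addrA.
    by rewrite -addrA; exact: gpartZ.
  apply: gpartD; first exact: gpartZ.
  case: d hf => [|d] hf; first by rewrite mderiv_homog0 // scale0r; exact: gpart0.
  have -> : d.+1%:Z + n = d%:Z + (n + 1) by lia.
  by apply: gpartZ; [exact: mderiv_homog | exact: gw].
- move=> [x y]; have [s [c [hc cs]]] := gpart_decomp x.
  have [t [e [he et]]] := gpart_decomp y.
  pose r := undup ([seq n - 1 | n <- s] ++ t).
  have ur : uniq r by exact: undup_uniq.
  exists r, (fun n => (c (n + 1), e n)); split=> [n|]; first by split.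
  rewrite twist_sum /= sum_shift -cs; first last.
  + move=> n ns; apply/mapP; exists (n - 1); last by rewrite subrK.
    by rewrite mem_undup mem_cat (map_f (fun n => n - 1)) // ns.
  + by rewrite map_inj_uniq //; exact: addIr.
  by rewrite -et // => n nt; rewrite mem_undup mem_cat nt orbT.
- move=> s c us hc; rewrite twist_sum => -[s1 s2] n ns.
  rewrite (surjective_pairing (c n)); congr pair; last first.
    by apply: (@gpart_uniq _ _ _ s (fun n => (c n).2)) => // k; case: (hc k).
  have := @gpart_uniq _ _ M [seq k + 1 | k <- s] (fun k => (c (k - 1)).1).
  rewrite -sum_shift map_inj_uniq //; last exact: addIr.
  move=> /(_ us) H; rewrite -[n](addrK 1); apply: H; last exact: map_f.
    by move=> k; case: (hc (k - 1)); rewrite subrK.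
  by rewrite -[RHS]s1; apply: eq_bigr => k _; rewrite addrK.
Qed.

Definition twist_gmodule : gmodule A m := GModule twist_is_grading.

End TwistGraded.

Definition derivation_along (M : gmodule A m) (D : M -> M) : Prop :=
  [/\ forall x y, D (x + y) = D x + D y,
      forall f x, D (f *: x) = f^`M(j) *: x + f *: D x &
      forall n x, gpart (n + 1) x -> gpart n (D x)].

Lemma derivation_along0 (M : gmodule A m) (D : M -> M) :
  derivation_along D -> D 0 = 0.
Proof. by case=> _ DZ _; rewrite -(scale0r 0) DZ mderiv0 !scale0r addr0. Qed.

(** The map (x, y) |-> y - w (D x) on the twisted product M x E is linear and
    extends to a graded map g on the twisted product E x E; g restricts to the
    identity on the second factor, which makes y |-> - g (y, 0) a Leibniz
    operator. *)
Lemma derivation_lift (M E : gmodule A m) (w : {linear M -> E}) (D : M -> M) :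
    graded_injective E -> graded_map w -> derivation_along D ->
    (forall x, w x = 0 -> w (D x) = 0) ->
  exists2 D' : E -> E, derivation_along D' & forall x, D' (w x) = w (D x).
Proof.
move=> Einj gw [DD DZ Dg] wD.
have gid : graded_map (idfun : {linear E -> E}) by [].
pose MM := twist_gmodule gw; pose EE := twist_gmodule gid.
pose u (x : MM) : EE := (w x.1, x.2).
pose f (x : MM) : E := x.2 - w (D x.1).
have u_lin : linear u.
  move=> a x y; congr pair; exact: linearP.
have f_lin : linear f.
  move=> a x y; rewrite /f.
  have -> : (a *: x + y).1 = a *: x.1 + y.1 by [].
  have -> : (a *: x + y).2 = a *: x.2 + a^`M(j) *: w x.1 + y.2 by [].
  have -> : w (D (a *: x.1 + y.1)) = a^`M(j) *: w x.1 + a *: w (D x.1) + w (D y.1).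
    by rewrite DD DZ !raddfD /= !linearZ.
  rewrite scalerBr (addrAC (a *: _)) -(addrA (_ *: w x.1)) opprD addrA addrK.
  by rewrite opprD addrACA.
pose ul := GRing.isLinear.Build _ _ _ _ u u_lin.
pose U : {linear MM -> EE} := HB.pack u ul.
pose fl := GRing.isLinear.Build _ _ _ _ f f_lin.
pose F : {linear MM -> E} := HB.pack f fl.
have gU : graded_map U by move=> n x [hx1 hx2]; split=> //; exact: (gw _ _ hx1).
have gF : graded_map F.
  by move=> n x [hx1 hx2]; apply: gpartB => //; exact/gw/Dg.
have UF x : U x = 0 -> F x = 0.
  by case: x => x y [/wD Dx ->]; rewrite /F /= /f /= Dx subrr.
have [g gg gE] := injective_extend gU Einj gF UF.
exists (fun y => - g ((y, 0) : EE)).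
  split=> [x y|a x|n x hx].
  - rewrite -opprD -raddfD; congr (- g _); congr pair; last by rewrite /= addr0.
  - have -> : (a *: x, 0) = a *: ((x, 0) : EE) - U (0, a^`M(j) *: x).
      transitivity ((a *: x - w 0, a *: 0 + a^`M(j) *: x - a^`M(j) *: x) : EE) => //.
      by rewrite raddf0 subr0 scaler0 add0r subrr.
    have gB p q : g (p - q) = g p - g q by exact: raddfB.
    have gZ p : g (a *: p) = a *: g p by exact: linearZ.
    rewrite gB gZ gE.
    rewrite /F /= /f /= (derivation_along0 (And3 DD DZ Dg)).
    by rewrite raddf0 subr0 opprB scalerN.
  - by rewrite -sub0r; apply: gpartB; [exact: gpart0 | apply: gg; split; last exact: gpart0].
move=> x; have /= -> := gE (x, 0).
by rewrite /f /= sub0r opprK.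
Qed.
End Twist.

(** * Derivations on local cohomology *)

Section LocalCohomologyDerivation.
Variables (A : comNzRingType) (m : nat).
Local Notation R := {mpoly A[m]}.

Lemma ring_derivation (j : 'I_m) :
  @derivation_along A m j (ring_gmodule A m) (mderiv j).
Proof.
split=> [x y|f x|n x /=].
- exact: mderivD.
- exact: mderivM.
- case En: (n + 1) => [[|d]|d] /= hx.
  + have -> : n = Negz 0 by lia.
    exact: mderiv_homog0.
  + have -> : n = Posz d by lia.
    exact: mderiv_homog.
  + have -> : n = Negz d.+1 by lia.
    by rewrite hx /= mderiv0.
Qed.

(** Exactness provides the compatibility with kernels that is needed to lift the
    operator from one term of the resolution to the next. *)
Lemma resolution_derivation (j : 'I_m) (M : gmodule A m) (D0 : M -> M)
    (I : graded_injective_resolution M) :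
  derivation_along j D0 ->
  exists D : forall k, I k -> I k, (forall k, derivation_along j (D k)) /\
    forall k x, D k.+1 (dif I k x) = dif I k (D k x).
Proof.
move=> dD0.
pose lift k := {D : I k -> I k | derivation_along j D /\
  forall x, dif I k x = 0 -> dif I k (D x) = 0}.
have [D' dD' eD'] : exists2 D' : I 0%N -> I 0%N, derivation_along j D' &
    forall x, D' (aug I x) = aug I (D0 x).
  apply: (derivation_lift (@res_injective _ _ _ I 0%N) (@aug_graded _ _ _ I) dD0).
  move=> x; rewrite -{1}(raddf0 (aug I)) => /aug_inj->.
  by rewrite (derivation_along0 dD0) raddf0.
have L0 : lift 0%N.
  exists D'; split=> // x /res_exact0[r <-]; rewrite eD'.
  by apply/res_exact0; exists (D0 r).
have step k (L : lift k) :
    {L' : lift k.+1 | forall x, sval L' (dif I k x) = dif I k (sval L x)}.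
  case: L => D [dD kD] /=; apply: cid.
  have [E dE eE] := derivation_lift (@res_injective _ _ _ I k.+1)
    (@dif_graded _ _ _ I k) dD kD.
  suff kE : forall x, dif I k.+1 x = 0 -> dif I k.+1 (E x) = 0.
    by exists (exist _ E (conj dE kE)).
  by move=> x /res_exact[y <-]; rewrite eE; apply/res_exact; exists (D y).
pose L := nat_rect lift L0 (fun k L => sval (step k L)).
exists (fun k => sval (L k)); split=> k; first by case: (svalP (L k)).
exact: (svalP (step k (L k))).
Qed.

Section Torsion.
Variable (J : R -> Prop).

Lemma torsion_prod (M : gmodule A m) (x : M) : torsion J x <->
  exists k, forall g : 'I_k -> R, (forall i, J (g i)) -> (\prod_i g i) *: x = 0.
Proof.
split=> -[k hk]; exists k.
  by move=> g hg; apply/hk/gen_ideal_incl; exists g.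
move=> _ [n [a [s [hs ->]]]]; rewrite scaler_suml big1 // => i _.
by have [g [hg ->]] := hs i; rewrite -scalerA hk // scaler0.
Qed.

Lemma mderiv_prod j n (g : 'I_n.+1 -> R) :
  (\prod_i g i)^`M(j) = \sum_i (g i)^`M(j) * \prod_(k < n) g (lift i k).
Proof.
elim: n g => [|n IHn] g.
  by rewrite !big_ord1 big_ord0 mulr1.
rewrite big_ord_recl mderivM IHn [RHS]big_ord_recl; congr (_ + _).
rewrite mulr_sumr; apply: eq_bigr => i _.
rewrite [in RHS]big_ord_recl mulrCA; congr (_ * (g _ * _)); first exact: val_inj.
by apply: eq_bigr => k _; congr g; apply: val_inj; rewrite /= /bump /= !add1n ltnS addnS.
Qed.

(** If all products of k elements of J kill x, then all products of k + 1 kill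
    D x, since each term of the derivative of such a product still contains k
    factors from J. *)
Lemma torsion_derivation j (M : gmodule A m) (D : M -> M) (x : M) :
  derivation_along j D -> torsion J x -> torsion J (D x).
Proof.
move=> dD /torsion_prod[k hk]; have [_ DZ _] := dD.
apply/torsion_prod; exists k.+1 => g hg.
apply: (@addrI _ ((\prod_i g i)^`M(j) *: x)); rewrite -DZ addr0.
have -> : (\prod_i g i)^`M(j) *: x = 0.
  rewrite mderiv_prod scaler_suml big1 // => i _.
  by rewrite -scalerA hk ?scaler0.
by rewrite big_ord_recl -scalerA hk // scaler0 (derivation_along0 dD).
Qed.

Lemma torsion0 (M : gmodule A m) : torsion J (0 : M).
Proof. by exists 0%N => f _; rewrite scaler0. Qed.

Lemma torsionZ (M : gmodule A m) f (x : M) : torsion J x -> torsion J (f *: x).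
Proof.
by case=> k hk; exists k => g hg; rewrite scalerA mulrC -scalerA hk // scaler0.
Qed.

Lemma torsionD (M : gmodule A m) (x y : M) :
  torsion J x -> torsion J y -> torsion J (x + y).
Proof.
move=> /torsion_prod[k hk] /torsion_prod[l hl]; apply/torsion_prod.
exists (k + l)%N => g hg; rewrite big_split_ord scalerDr /=.
rewrite -[X in _ + X]scalerA (hl (fun i => g (rshift k i))) // scaler0 addr0.
by rewrite mulrC -scalerA (hk (fun i => g (lshift l i))) // scaler0.
Qed.

End Torsion.

Section Annihilator.
Variables (J : R -> Prop) (M : gmodule A m) (I : graded_injective_resolution M).

Lemma coboundaryD i (x y : I i) :
  lc_coboundary J x -> lc_coboundary J y -> lc_coboundary J (x + y).
Proof.
case: i x y => [|i] x y /=; first by move=> -> ->; rewrite addr0.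
move=> [a ta <-] [b tb <-]; exists (a + b); first exact: torsionD.
exact: raddfD.
Qed.

Lemma coboundaryZ i f (x : I i) : lc_coboundary J x -> lc_coboundary J (f *: x).
Proof.
case: i x => [|i] x /=; first by move=> ->; rewrite scaler0.
by move=> [a ta <-]; exists (f *: a); [exact: torsionZ | exact: linearZ].
Qed.

Lemma coboundary0 i : lc_coboundary J (0 : I i).
Proof.
by case: i => [|i] //=; exists 0; [exact: torsion0 | exact: raddf0].
Qed.

(** The annihilator of the class of u in local cohomology. *)
Definition class_ann i (u : I i) : R -> Prop := fun f => lc_coboundary J (f *: u).

Lemma class_ann_ideal i (u : I i) : ideal (class_ann u).
Proof.
split=> [|f g|f g]; rewrite /class_ann.
- by rewrite scale0r; exact: coboundary0.
- by rewrite scalerDl; exact: coboundaryD.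
- by rewrite -scalerA; exact: coboundaryZ.
Qed.

(** The class of D u lies in degree -1, hence vanishes, and
    (d_j f) u = D (f u) - f (D u). *)
Lemma class_ann_differential j (D0 : M -> M) i (u : I i) :
    derivation_along j D0 -> lc_part_eq0 J I i (-1) ->
    gpart 0 u -> lc_cocycle J u ->
  forall f, class_ann u f -> class_ann u f^`M(j).
Proof.
move=> dD0 H0 gu [tu du] f.
have [D [dD DE]] := resolution_derivation I dD0.
have [_ DZ Dg] := dD i; rewrite /class_ann => fu.
have Du : lc_coboundary J (D i u).
  apply: H0; first by apply: Dg; rewrite addNr.
  split; first exact: torsion_derivation (dD i) tu.
  by rewrite -DE du (derivation_along0 (dD _)).
have -> : f^`M(j) *: u = D i (f *: u) + (- f) *: D i u.
  by rewrite DZ scaleNr addrK.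
apply: coboundaryD; last exact: coboundaryZ.
case: i u gu tu du fu D dD DE DZ Dg Du H0 => [|i] u gu tu du /= fu D dD DE DZ Dg Du H0.
  by rewrite fu (derivation_along0 (dD 0%N)).
case: fu => v tv <-; exists (D i v); first exact: torsion_derivation (dD i) tv.
by rewrite DE.
Qed.

End Annihilator.

Definition content (J : R -> Prop) : A -> Prop :=
  gen_ideal (fun a => exists f b, J f /\ a = f@_b).

Lemma content_extended J : subideal J (extended_ideal (content J)).
Proof.
move=> f Jf; rewrite [f]mpolyE; apply: ideal_sum => [|b _]; first exact: gen_idealP.
rewrite -mul_mpolyC mulrC; have [_ _] := gen_idealP (fun f : R =>
  exists2 q, content J q & f = q%:MP); apply; apply: gen_ideal_incl.
by exists (f@_b) => //; apply: gen_ideal_incl; exists f, b.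
Qed.

Lemma content_sub J (I : R -> Prop) : ideal I ->
  (forall f b, J f -> I (f@_b)%:MP) -> forall a, content J a -> I a%:MP.
Proof.
move=> [h0 hD hM] H; apply: gen_ideal_min => [|_ [f [b [Jf ->]]]]; last exact: H.
split; first by rewrite mpolyC0.
  by move=> x y hx hy; rewrite mpolyCD; exact: hD.
by move=> a x hx; rewrite mpolyCM; exact: hM.
Qed.

End LocalCohomologyDerivation.

Lemma natr_inv_of_pchar0 (A : comNzRingType) (K : fieldType)
    (iota : {rmorphism K -> A}) n :
  [pchar K] =i pred0 -> exists b : A, b * n.+1%:R = 1.
Proof.
move=> /pcharf0P charK; exists (iota (n.+1%:R^-1)).
by rewrite -(rmorph_nat iota) -rmorphM mulVf ?rmorph1 // charK.
Qed.

Theorem theorem1p5 (A : idomainType) (regA : regular_ring A)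
    (K : fieldType) (charK : [pchar K] =i pred0) (iota : {rmorphism K -> A})
    (m : nat) (m_ge1 : (1 <= m)%N) (i : nat)
    (J : {mpoly A[m]} -> Prop)
    (J_proper : is_proper_ideal J) (J_homog : homogeneous_ideal J)
    (I : graded_injective_resolution (ring_gmodule A m))
    (H_nonneg : forall n : int, 0 <= n -> ~ lc_part_eq0 J I i n)
    (H_neg : forall n : int, n < 0 -> lc_part_eq0 J I i n) :
  exists Q : A -> Prop, is_proper_ideal Q /\ subideal J (extended_ideal Q).
Proof.
have natU n : exists b : A, b * n.+1%:R = 1 := natr_inv_of_pchar0 iota n charK.
have natU' n : exists b : {mpoly A[m]}, b * n.+1%:R = 1.
  by have [b hb] := natU n; exists b%:MP; rewrite -mpolyC_nat -mpolyCM hb.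
exists (content J); split; last exact: content_extended.
split; first exact: gen_idealP.
move=> J1; apply: (H_nonneg 0) => // u gu cu.
have idu := class_ann_ideal J u; have idr := radical_ideal idu.
have dI j f : radical (class_ann J u) f -> radical (class_ann J u) f^`M(j).
  apply: (radical_differential (mderivM j) idu natU').
  exact: (class_ann_differential (ring_derivation A j) (H_neg (-1) isT) gu cu).
have rJ f : J f -> radical (class_ann J u) f.
  move=> Jf; have [[k hk] _] := cu; exists k; rewrite /class_ann hk; first exact: coboundary0.
  by apply: gen_ideal_incl; exists (fun=> f); rewrite prodr_const card_ord.
have [k] := content_sub idr
  (fun f b Jf => differential_ideal_coeff natU b idr dI (rJ f Jf)) J1.
by rewrite mpolyC1 expr1n /class_ann scale1r.
Qed.
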